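(* Suppose the loss function $\ell(\boldsymbol x,\boldsymbol\xi)=\boldsymbol a(\boldsymbol x)^\top\boldsymbol\xi+b$ is a linear function of $\boldsymbol x$ and the feasible set $\mathcal X$ is second-order conic representable. Then the regularized problem $$\min_{\boldsymbol x\in\mathcal X}\ \hat{\mathbb E}_{\boldsymbol\gamma}[\ell(\boldsymbol x,\tilde{\boldsymbol\xi})]+\lambda\sqrt{\hat{\mathbb V}_{\boldsymbol\gamma}[\ell(\boldsymbol x,\tilde{\boldsymbol\xi})]}$$ can equivalently be reformulated as the second-order cone program $$\begin{array}{cll} \min & \overline{\boldsymbol w}^\top\boldsymbol\nu+\lambda\rho\\ \text{s.t.} & \big(\sqrt{\overline w_1}(\nu_1-t),\ldots,\sqrt{\overline w_n}(\nu_n-t),\rho\big)\in\mathcal{SOC}(n+1),\\ & \boldsymbol a(\boldsymbol x)^\top\boldsymbol\xi^i+b=\nu_i & \forall i\in[n],\\ & \boldsymbol x\in\mathcal X,\ \boldsymbol\nu\in\mathbb R^n,\ \rho\in\mathbb R,\ t\in\mathbb R. \end{array}$$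
   Context: Data $(\boldsymbol\gamma^i,\boldsymbol\xi^i)\in\mathbb R^p\times\mathbb R^q$, $i\in[n]=\{1,\dots,n\}$, a fixed $\boldsymbol\gamma\in\mathbb R^p$, a bandwidth $h>0$ and a regularization parameter $\lambda\ge0$ are given; $\mathcal X\subseteq\mathbb R^d$ is the feasible set. The kernel is $\mathcal K(\boldsymbol\theta)=\frac1Z\exp(-\|\boldsymbol\theta\|_2)$ with $Z=\int_{\mathbb R^p}\exp(-\|\boldsymbol\theta\|_2)\,d\boldsymbol\theta$, and the kernel weights are $\overline w_i=\mathcal K\big(\frac{\boldsymbol\gamma-\boldsymbol\gamma^i}{h}\big)/\sum_{j=1}^n\mathcal K\big(\frac{\boldsymbol\gamma-\boldsymbol\gamma^j}{h}\big)$. The Nadaraya-Watson estimator is $\hat{\mathbb E}_{\boldsymbol\gamma}[\ell(\boldsymbol x,\tilde{\boldsymbol\xi})]=\sum_{i=1}^n\overline w_i\,\ell(\boldsymbol x,\boldsymbol\xi^i)$, and the empirical conditional variance is $\hat{\mathbb V}_{\boldsymbol\gamma}[\ell(\boldsymbol x,\tilde{\boldsymbol\xi})]=\sum_{i=1}^n\overline w_i\big(\ell(\boldsymbol x,\boldsymbol\xi^i)-\hat{\mathbb E}_{\boldsymbol\gamma}[\ell(\boldsymbol x,\tilde{\boldsymbol\xi})]\big)^2$. The second-order cone $\mathcal{SOC}(n+1)\subseteq\mathbb R^{n+1}$ is defined by $\boldsymbol v\in\mathcal{SOC}(n+1)\iff\|(v_1,\dots,v_n)^\top\|\le v_{n+1}$.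 *)

(* Defs.v *)
From HB Require Import structures.
From mathcomp Require Import all_boot all_order all_algebra.
From mathcomp Require Import all_classical all_reals all_analysis.

Set Implicit Arguments.
Unset Strict Implicit.
Unset Printing Implicit Defensive.

Import Order.TTheory GRing.Theory Num.Theory.
Import numFieldNormedType.Exports.

Local Open Scope classical_set_scope.
Local Open Scope ring_scope.

Definition dotp (R : realType) (k : nat) (u v : 'cV[R]_k) : R :=
  \sum_(i < k) u i 0 * v i 0.

(* The norm [`|v|] of the library on matrices is the max norm. *)
Definition norm2 (R : realType) (k : nat) (v : 'cV[R]_k) : R :=
  Num.sqrt (\sum_(i < k) v i 0 ^+ 2).

(* Lebesgue measure on R^k, carried by the product sigma-algebra of
   [k.-tuple R]: the k-fold product of the Lebesgue measure on R, transported
   along (x, t) |-> x :: t (a unit point mass when k = 0). *)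
Fixpoint lebesgue_tuple (R : realType) (k : nat) :
    set (k.-tuple (measurableTypeR R)) -> \bar R :=
  match k with
  | 0 => fun A => (\d_[tuple] A)%E
  | k'.+1 => fun A =>
      (@lebesgue_measure R \x @lebesgue_tuple R k')%E
        [set z | A (cons_tuple z.1 z.2)]
  end.

Definition kernel_Z (R : realType) (p : nat) : R :=
  fine (\int[@lebesgue_tuple R p]_t
    (expR (- norm2 (\col_(i < p) (tnth t i : R))))%:E)%E.

Definition kernel (R : realType) (p : nat) (theta : 'cV[R]_p) : R :=
  (kernel_Z R p)^-1 * expR (- norm2 theta).

Definition kernel_weight (R : realType) (p n : nat) (gam : 'I_n -> 'cV[R]_p)
    (g : 'cV[R]_p) (h : R) (i : 'I_n) : R :=
  kernel (h^-1 *: (g - gam i)) / \sum_(j < n) kernel (h^-1 *: (g - gam j)).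

Definition nw_mean (R : realType) (n : nat) (w : 'I_n -> R) (T : Type)
    (f : T -> R) (xi : 'I_n -> T) : R :=
  \sum_(i < n) w i * f (xi i).

Definition nw_variance (R : realType) (n : nat) (w : 'I_n -> R) (T : Type)
    (f : T -> R) (xi : 'I_n -> T) : R :=
  \sum_(i < n) w i * (f (xi i) - nw_mean w f xi) ^+ 2.

(* SOC(m + 1): the first m coordinates are [usubmx v], the last is [dsubmx v]. *)
Definition soc (R : realType) (m : nat) : set 'cV[R]_(m + 1) :=
  [set v | norm2 (usubmx v) <= dsubmx v 0 0].

Definition affine (R : realType) (V W : lmodType R) (f : V -> W) : Prop :=
  exists c : W, linear (fun v => f v - c).

(* S is the projection, along auxiliary variables u, of the solution set of
   finitely many second-order cone constraints on affine functions of (v, u). *)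
Definition soc_representable (R : realType) (V : lmodType R) (S : set V) :
    Prop :=
  exists (k N : nat) (m : 'I_N -> nat)
         (F : forall i : 'I_N, V * 'cV[R]_k -> 'cV[R]_(m i + 1)),
    (forall i, affine (F i)) /\
    (forall v, S v <-> exists u, forall i, soc (F i (v, u))).

Record program (R : realType) (V : Type) :=
  Program { objective : V -> R; feasible : set V }.

Definition optimal_value (R : realType) (V : Type) (P : program R V) : \bar R :=
  ereal_inf [set (objective P v)%:E | v in feasible P].

Definition is_solution (R : realType) (V : Type) (P : program R V) (v : V) :
    Prop :=
  feasible P v /\ forall v', feasible P v' -> objective P v <= objective P v'.

Definition is_socp (R : realType) (V : lmodType R) (P : program R V) : Prop :=
  linear (objective P : V -> R^o) /\ soc_representable (feasible P).

(* Q, whose decision v carries the decision [proj v] of P, reformulates P: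
   same optimal value, same optimal decisions, and, so that non-attained minima
   are covered as well, the same decisions at every objective level. *)
Definition reformulates (R : realType) (V W : Type) (proj : V -> W)
    (Q : program R V) (P : program R W) : Prop :=
  [/\ optimal_value Q = optimal_value P,
      forall x, is_solution P x <->
                exists v, proj v = x /\ is_solution Q v
    & forall x c, (feasible P x /\ objective P x <= c) <->
                  exists v, [/\ proj v = x, feasible Q v & objective Q v <= c]].

Definition regularized_problem (R : realType) (d q n : nat) (w : 'I_n -> R)
    (lambda : R) (xi : 'I_n -> 'cV[R]_q) (X : set 'cV[R]_d)
    (ell : 'cV[R]_d -> 'cV[R]_q -> R) : program R 'cV[R]_d :=
  Program
    (fun x => nw_mean w (ell x) xi
              + lambda * Num.sqrt (nw_variance w (ell x) xi))
    X.

(* Decision variables (x, nu, rho, t). *)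
Definition conic_vars (R : realType) (d n : nat) : lmodType R :=
  ('cV[R]_d * 'cV[R]_n * R^o * R^o)%type.

Definition conic_x (R : realType) (d n : nat) (v : conic_vars R d n) :
    'cV[R]_d :=
  v.1.1.1.

Definition conic_problem (R : realType) (d q n : nat) (w : 'I_n -> R)
    (lambda : R) (xi : 'I_n -> 'cV[R]_q) (X : set 'cV[R]_d)
    (a : 'cV[R]_d -> 'cV[R]_q) (b : R) : program R (conic_vars R d n) :=
  Program
    (fun v : conic_vars R d n => let: (x, nu, rho, t) := v in
       \sum_(i < n) w i * nu i 0 + lambda * rho)
    [set v : conic_vars R d n | let: (x, nu, rho, t) := v in
       [/\ soc (col_mx (\col_(i < n) (Num.sqrt (w i) * (nu i 0 - t)))
                       (const_mx rho)),
           forall i : 'I_n, dotp (a x) (xi i) + b = nu i 0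
         & X x]].

(* Main.v *)
(** For weights summing to 1, the weighted mean minimizes
    [t |-> \sum_i w_i (nu_i - t)^2], and the minimum is the variance. Hence, for
    fixed [x], the smallest [rho] allowed by the cone is the standard deviation,
    reached at [t] = mean; as [lambda >= 0], partial minimization over
    [(nu, rho, t)] gives back the regularized objective. *)

Require Import Defs.
From mathcomp Require Import all_boot all_order all_algebra.
From mathcomp Require Import all_classical all_reals all_analysis.
From mathcomp Require Import ring.
Import Order.TTheory GRing.Theory Num.Theory.
Import numFieldNormedType.Exports.
Local Open Scope classical_set_scope.
Local Open Scope ring_scope.

Set Implicit Arguments.
Unset Strict Implicit.
Unset Printing Implicit Defensive.

(** * Euclidean norm *)

Lemma norm2_ge0 (R : realType) (k : nat) (v : 'cV[R]_k) : 0 <= norm2 v.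
Proof. exact: sqrtr_ge0. Qed.

Lemma norm2_le0 (R : realType) (k : nat) (v : 'cV[R]_k) :
  (norm2 v <= 0) = (v == 0).
Proof.
(* By nonnegativity [<= 0] means [= 0], first for the root and then for the sum of squares, which
   vanishes exactly when each term does. *)
rewrite le_eqVlt ltNge norm2_ge0 orbF sqrtr_eq0 le_eqVlt ltNge.
have sq_ge0 (i : 'I_k) : true -> 0 <= v i 0 ^+ 2 by rewrite sqr_ge0.
rewrite (sumr_ge0 _ sq_ge0) orbF psumr_eq0 //.
apply/allP/eqP => [v0|-> i _]; last by rewrite mxE expr0n eqxx.
apply/colP => i; rewrite mxE; apply/eqP; rewrite -sqrf_eq0.
by apply: v0; rewrite mem_index_enum.
Qed.

Lemma norm2_weighted (R : realType) (n : nat) (w f : 'I_n -> R) :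
  (forall i, 0 <= w i) ->
  norm2 (\col_(i < n) (Num.sqrt (w i) * f i)) =
    Num.sqrt (\sum_(i < n) w i * f i ^+ 2).
Proof.
move=> w_ge0; congr Num.sqrt; apply: eq_bigr => i _.
by rewrite mxE exprMn sqr_sqrtr.
Qed.

(** * Affine maps *)

Lemma affineP (R : realType) (V W : lmodType R) (f : V -> W) :
  affine f <-> linear (fun v => f v - f 0).
Proof.
split=> [[c fl] s u v|fl]; last by exists (f 0).
(* A linear map vanishes at 0, so the constant of an affine map is forced to be its value at 0. *)
have f0 : f 0 = c.
  have := fl (-1) 0 0; rewrite scaler0 addr0 scaleN1r addNr.
  by move/eqP; rewrite subr_eq0 => /eqP.
by rewrite f0 fl.
Qed.

Lemma affine_comp_linear (R : realType) (U V W : lmodType R) (f : V -> W)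
    (g : U -> V) : affine f -> linear g -> affine (f \o g).
Proof.
by move=> [c fl] gl; exists c => s u v; rewrite /= gl fl.
Qed.

Lemma linear_affine (R : realType) (V W : lmodType R) (f : V -> W) :
  linear f -> affine f.
Proof. by move=> fl; exists 0 => s u v; rewrite !subr0 fl. Qed.

Lemma affineB (R : realType) (V W : lmodType R) (f g : V -> W) :
  affine f -> affine g -> affine (fun v => f v - g v).
Proof.
move=> [c fl] [e gl]; exists (c - e) => s u v.
have E z : f z - g z - (c - e) = (f z - c) - (g z - e).
  by rewrite !opprB addrACA [RHS]addrACA [- c - _]addrC.
by rewrite !E fl gl opprD addrACA -scalerBr.
Qed.

Lemma affine_col_mx (R : realType) (V : lmodType R) (k l : nat)
    (f : V -> 'cV[R]_k) (g : V -> 'cV[R]_l) :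
  affine f -> affine g -> affine (fun v => col_mx (f v) (g v)).
Proof.
move=> [c fl] [e gl]; exists (col_mx c e) => s u v.
by rewrite !opp_col_mx !add_col_mx fl gl scale_col_mx add_col_mx.
Qed.

Lemma affine_col (R : realType) (V : lmodType R) (k : nat)
    (f : 'I_k -> V -> R^o) :
  (forall i, affine (f i)) -> affine (fun v => \col_(i < k) f i v : 'cV[R]_k).
Proof.
(* By [affineP], [f i 0] serves as the constant of each coordinate, so no family of constants has to
   be chosen. *)
move=> fa; exists (\col_(i < k) f i 0) => s u v.
by apply/colP => i; rewrite !mxE; have /affineP fl := fa i; exact: fl.
Qed.

(** * Calculus of second-order conic representable sets *)

Lemma soc_representable_preimage (R : realType) (V W : lmodType R)
    (L : V -> W) (S : set W) :
  linear L -> soc_representable S -> soc_representable (L @^-1` S).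
Proof.
move=> Ll [k [N [m [F [Fa FS]]]]].
exists k, N, m, (fun i => F i \o (fun z => (L z.1, z.2))); split=> [i|v].
  apply: affine_comp_linear => // s u v.
  by congr pair; exact: Ll.
exact: FS.
Qed.

Lemma soc_representable_soc (R : realType) (V : lmodType R) (m : nat)
    (f : V -> 'cV[R]_(m + 1)) :
  affine f -> soc_representable (f @^-1` @soc R m).
Proof.
move=> fa; exists 0%N, 1%N, (fun=> m), (fun=> f \o fst); split=> [_|v].
  exact: affine_comp_linear.
split=> [fv|[u /(_ ord0)//]].
by exists 0.
Qed.

(** The auxiliary vectors are stacked and the two families of constraints are put side by side, each
    reading its own block of the stacked vector. *)
Lemma soc_representable_setI (R : realType) (V : lmodType R) (S T : set V) :
  soc_representable S -> soc_representable T -> soc_representable (S `&` T).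
Proof.
move=> [k [N [m [F [Fa FS]]]]] [l [M [r [G [Ga GT]]]]].
pose mr (i : 'I_N + 'I_M) := match i with inl i => m i | inr j => r j end.
(* The cone dimension varies with the constraint, hence a dependent match on the sum type;
   [fintype.split] transports it to ['I_(N + M)]. *)
pose H (i : 'I_N + 'I_M) : V * 'cV[R]_(k + l) -> 'cV[R]_(mr i + 1) :=
  match i return V * 'cV[R]_(k + l) -> 'cV[R]_(mr i + 1) with
  | inl i => F i \o (fun z => (z.1, usubmx z.2))
  | inr j => G j \o (fun z => (z.1, dsubmx z.2))
  end.
exists (k + l)%N, (N + M)%N, (mr \o @fintype.split N M), (fun i => H (fintype.split i)).
split=> [i|v].
  rewrite /=; case: (fintype.split i) => j.
    apply: affine_comp_linear; first exact: Fa.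
    by move=> s u v; congr pair; exact: linearP.
  apply: affine_comp_linear; first exact: Ga.
  by move=> s u v; congr pair; exact: linearP.
rewrite /setI /= FS GT; split=> [[[u Fu] [u' Gu]]|[u Hu]].
  exists (col_mx u u') => i; case: (fintype.split i) => j /=.
    by rewrite col_mxKu.
  by rewrite col_mxKd.
split; [exists (usubmx u) => i|exists (dsubmx u) => j].
  by have := Hu (unsplit (inl i)); rewrite unsplitK.
by have := Hu (unsplit (inr j)); rewrite unsplitK.
Qed.

(** An equation is the cone constraint whose last coordinate is 0: a norm is at most 0 only at the
    zero vector. *)
Lemma soc_representable_eq0 (R : realType) (V : lmodType R) (m : nat)
    (f : V -> 'cV[R]_m) :
  affine f -> soc_representable [set v | f v = 0].
Proof.
move=> fa.
rewrite (_ : mkset _ =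
  (fun v => col_mx (f v) 0 : 'cV[R]_(m + 1)) @^-1` @soc R m).
  apply: soc_representable_soc; apply: affine_col_mx => //.
  by apply: linear_affine => s u v; rewrite scaler0 addr0.
apply/seteqP; split=> v; rewrite /soc /= col_mxKu col_mxKd mxE norm2_le0.
  by move=> ->.
by move/eqP.
Qed.

(** Partial minimization: projecting never increases the objective, and [lift] is a section of
    [proj] that preserves it, so bounds and minimizers transfer both ways. *)
Lemma reformulates_lift (R : realType) (V W : Type) (proj : V -> W)
    (lift : W -> V) (Q : program R V) (P : program R W) :
  (forall v, feasible Q v -> feasible P (proj v)) ->
  (forall v, feasible Q v -> objective P (proj v) <= objective Q v) ->
  (forall x, proj (lift x) = x) ->
  (forall x, feasible P x -> feasible Q (lift x)) ->
  (forall x, objective Q (lift x) = objective P x) ->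
  reformulates proj Q P.
Proof.
move=> proj_feas proj_le liftK lift_feas lift_obj; split.
- apply/eqP; rewrite eq_le; apply/andP; split; apply: le_ereal_inf_tmp => y [].
    move=> x Px <-; apply: ereal_inf_lbound; exists (lift x); first exact: lift_feas.
    by rewrite lift_obj.
  move=> v Qv <-; apply: (@le_trans _ _ (objective P (proj v))%:E).
    by apply: ereal_inf_lbound; exists (proj v) => //; exact: proj_feas.
  by rewrite lee_fin proj_le.
- move=> x; split=> [[Px xmin]|[v [<- [Qv vmin]]]].
    exists (lift x); split; first exact: liftK.
    split=> [|v Qv]; first exact: lift_feas.
    rewrite lift_obj; apply: le_trans (proj_le _ Qv).
    by apply: xmin; exact: proj_feas.
  split=> [|x' Px]; first exact: proj_feas.
  rewrite (le_trans (proj_le _ Qv))// -lift_obj.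
  by apply: vmin; exact: lift_feas.
- move=> x c; split=> [[Px xc]|[v [<- Qv vc]]].
    by exists (lift x); split; [exact: liftK|exact: lift_feas|rewrite lift_obj].
  by split; [exact: proj_feas|exact: le_trans (proj_le _ Qv) vc].
Qed.

(** Bias-variance decomposition: the two sides differ by the square of the mean minus [t]. *)
Lemma nw_variance_le (R : realType) (n : nat) (w : 'I_n -> R) (T : Type)
    (f : T -> R) (xi : 'I_n -> T) (t : R) :
  \sum_(i < n) w i = 1 ->
  nw_variance w f xi <= \sum_(i < n) w i * (f (xi i) - t) ^+ 2.
Proof.
move=> w1; rewrite /nw_variance; set mu := nw_mean w f xi.
rewrite -subr_ge0 -sumrB.
rewrite (_ : \sum_(i < n) _ = (mu - t) ^+ 2) ?sqr_ge0//.
(* Factoring the difference of squares leaves each term affine in [f (xi i)], so only the mean and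
   the total weight 1 enter the sum. *)
transitivity (\sum_(i < n) (2 * (mu - t) * (w i * f (xi i))
                            - (mu - t) * (mu + t) * w i)).
  by apply: eq_bigr => i _; ring.
by rewrite sumrB -!mulr_sumr w1 -/(nw_mean w f xi) -/mu; ring.
Qed.

(* The normalization [kernel_Z] cancels in the quotient unless it is 0, in which
   case [x / 0 = 0] makes all weights vanish; the reformulation holds in both
   cases, so the integral need not be known to be finite. *)
Lemma kernel_weightP (R : realType) (p n : nat) (gam : 'I_n -> 'cV[R]_p)
    (g : 'cV[R]_p) (h : R) :
  (0 < n)%N ->
  (forall i, 0 <= kernel_weight gam g h i) /\
  (\sum_(i < n) kernel_weight gam g h i = 1 \/
   forall i, kernel_weight gam g h i = 0).
Proof.
move=> n_gt0; rewrite /kernel_weight /Defs.kernel -mulr_sumr.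
set z := (kernel_Z R p)^-1; set e := fun i => expR (- norm2 (h^-1 *: (g - gam i))).
have [->|z0] := eqVneq z 0.
  by split=> [i|]; [|right=> i]; rewrite !mul0r.
have e_gt0 : 0 < \sum_(i < n) e i.
  rewrite (bigD1 (Ordinal n_gt0)) //= ltr_pwDl ?expR_gt0//.
  by apply: sumr_ge0 => i _; exact: expR_ge0.
have wE i : z * e i / (z * \sum_(j < n) e j) = e i / \sum_(j < n) e j.
  by rewrite -mulf_div divff// mul1r.
split=> [i|]; first by rewrite wE divr_ge0 ?expR_ge0 ?ltW.
left; rewrite (eq_bigr _ (fun i _ => wE i)) -mulr_suml divff//.
by rewrite gt_eqF.
Qed.

(** The feasible set is an intersection of three representable sets: a cone constraint, a system of
    affine equations, and the preimage of [X] under a linear projection. *)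
Lemma conic_problem_is_socp (R : realType) (d q n : nat) (w : 'I_n -> R)
    (lambda : R) (xi : 'I_n -> 'cV[R]_q) (X : set 'cV[R]_d)
    (a : 'cV[R]_d -> 'cV[R]_q) (b : R) :
  (forall z, affine (fun x => dotp (a x) z + b : R^o)) ->
  soc_representable X ->
  is_socp (conic_problem w lambda xi X a b).
Proof.
move=> a_aff X_soc; split.
  move=> s [[[x nu] rho] t] [[[x' nu'] rho'] t'] /=.
  rewrite /GRing.scale /= !mulrDr mulr_sumr addrACA -big_split /=.
  congr (_ + _); last by ring.
  by apply: eq_bigr => i _; rewrite !mxE; ring.
pose cone (v : conic_vars R d n) : 'cV[R]_(n + 1) :=
  col_mx (\col_(i < n) (Num.sqrt (w i) * (v.1.1.2 i 0 - v.2)))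
         (const_mx v.1.2).
pose gap (v : conic_vars R d n) : 'cV[R]_n :=
  \col_(i < n) (dotp (a v.1.1.1) (xi i) + b - v.1.1.2 i 0).
rewrite (_ : feasible _ =
  (cone @^-1` @soc R n `&` [set v | gap v = 0]) `&` (@conic_x R d n) @^-1` X).
  apply: soc_representable_setI; last exact: soc_representable_preimage.
  apply: soc_representable_setI.
    apply: soc_representable_soc; apply: linear_affine.
    move=> s [[[x nu] rho] t] [[[x' nu'] rho'] t'].
    rewrite /cone scale_col_mx add_col_mx; congr col_mx; apply/colP => i;
      rewrite !mxE //=.
    by rewrite [s *: t](_ : _ = s * t)//; ring.
  apply: soc_representable_eq0; apply: affine_col => i.
  apply: affineB.
    have xl : linear (@conic_x R d n) by [].
    exact: affine_comp_linear (a_aff (xi i)) xl.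
  by apply: linear_affine => s u v; rewrite !mxE.
apply/seteqP; split=> [[[[x nu] rho] t] [/= vsoc vgap Xx]|].
  split=> //; split=> //; apply/colP => i.
  by rewrite !mxE /= vgap subrr.
move=> [[[x nu] rho] t] [[/= vsoc vgap] Xx]; split=> // i.
by have /colP/(_ i)/eqP := vgap; rewrite !mxE subr_eq0 => /eqP.
Qed.

Lemma conic_problem_reformulates (R : realType) (d q n : nat) (w : 'I_n -> R)
    (lambda : R) (xi : 'I_n -> 'cV[R]_q) (X : set 'cV[R]_d)
    (ell : 'cV[R]_d -> 'cV[R]_q -> R) (a : 'cV[R]_d -> 'cV[R]_q) (b : R) :
  (forall i, 0 <= w i) ->
  \sum_(i < n) w i = 1 \/ (forall i, w i = 0) ->
  0 <= lambda ->
  (forall x z, ell x z = dotp (a x) z + b) ->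
  reformulates (@conic_x R d n)
    (conic_problem w lambda xi X a b)
    (regularized_problem w lambda xi X ell).
Proof.
move=> w_ge0 w_sum lambda_ge0 ellE.
(* The optimal completion of [x]: [nu] holds the losses, [rho] the standard deviation and [t] the
   mean. *)
pose lift x : conic_vars R d n :=
  (x, \col_(i < n) ell x (xi i), Num.sqrt (nw_variance w (ell x) xi),
   nw_mean w (ell x) xi).
apply: (@reformulates_lift _ _ _ _ lift) => //.
- by move=> [[[x nu] rho] t] [].
- move=> [[[x nu] rho] t] /= [+ nuE _].
  rewrite /soc /= col_mxKu col_mxKd mxE norm2_weighted// => rho_ge.
  have {}nuE i : nu i 0 = ell x (xi i) by rewrite ellE nuE.
  rewrite /conic_x /= /nw_mean (eq_bigr _ (fun i _ => congr1 _ (nuE i))) lerD2l.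
  apply: ler_wpM2l => //; apply: le_trans rho_ge; apply: ler_wsqrtr.
  under [leRHS]eq_bigr do rewrite nuE.
  (* If all weights are 0, both the variance and the sum inside the cone constraint are 0. *)
  case: w_sum => [w1|w0]; first exact: nw_variance_le.
  by rewrite /nw_variance !big1// => i _; rewrite w0 mul0r.
- move=> x Xx; split=> // [|i]; last by rewrite mxE ellE.
  rewrite /soc /= col_mxKu col_mxKd mxE norm2_weighted// /nw_variance.
  by under eq_bigr do rewrite mxE.
- by move=> x /=; congr (_ + _); apply: eq_bigr => i _; rewrite mxE.
Qed.

Theorem corollary3 (R : realType) (d p q n : nat)
    (gam : 'I_n -> 'cV[R]_p) (xi : 'I_n -> 'cV[R]_q) (g : 'cV[R]_p)
    (h lambda : R) (X : set 'cV[R]_d)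
    (ell : 'cV[R]_d -> 'cV[R]_q -> R) (a : 'cV[R]_d -> 'cV[R]_q) (b : R)
    (n_gt0 : (0 < n)%N) (h_gt0 : 0 < h) (lambda_ge0 : 0 <= lambda)
    (ellE : forall x z, ell x z = dotp (a x) z + b)
    (ell_affine : forall z, affine (fun x => ell x z : R^o))
    (X_soc : soc_representable X) :
  let w := kernel_weight gam g h in
  is_socp (conic_problem w lambda xi X a b) /\
  reformulates (@conic_x R d n)
    (conic_problem w lambda xi X a b)
    (regularized_problem w lambda xi X ell).
Proof.
move=> w; split.
  apply: conic_problem_is_socp => // z.
  (* Affinity is assumed of the loss in [x]; [ellE] turns it into affinity of the constraint
     functions. *)
  have [c cl] := ell_affine z; exists c => s u v.
  by rewrite -!ellE; exact: cl.
have [w_ge0 w_sum] := kernel_weightP gam g h n_gt0.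
exact: conic_problem_reformulates.
Qed.
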